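(* Let $p$ be a prime, $n>1$ an integer, and $\alpha=(\alpha_1,\dots,\alpha_{n-1})$ a tuple of integers with $\alpha_i>1$ for every $i\in\{1,\dots,n-1\}$. Let $1\le t\le n-1$, and for $k\in\mathbb{Z}_{\ge1}$ let $\alpha_{/k,t}$ be the tuple obtained from $\alpha$ by replacing $\alpha_t$ with $k\alpha_t$ (all other entries unchanged). Let $\gamma=\max\{\alpha_1,\dots,\alpha_t\}$. Then \[ g_{\alpha_{/k,t}}(p)=O\big(p^{\gamma k(n-2)}\big)\quad\text{as } k\to\infty,\] where the implied constant depends on $p$ and $n$ but not on $k$.
   Context: $\mathbb{Z}^n$ denotes the ring of integer $n$-tuples with componentwise operations. For a prime $p$ and a tuple $\beta=(\beta_1,\dots,\beta_{n-1})$ of positive integers, an irreducible subring matrix with diagonal $\beta$ is an $n\times n$ upper triangular integer matrix $A$ with $A_{ii}=p^{\beta_i}$ for $1\le i\le n-1$, $A_{nn}=1$, $A_{in}=1$ for all $i$, and $A_{ij}=p\,a_{ij}$ with integers $0\le a_{ij}\le p^{\beta_i-1}-1$ for $1\le i<j\le n-1$, such that the $\mathbb{Z}$-span of the columns of $A$ is closed under componentwise multiplication of vectors. $g_\beta(p)$ denotes the number of irreducible subring matrices with diagonal $\beta$. *)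

(* Defs.v *)
From mathcomp Require Import all_boot all_order all_algebra finmap.
From mathcomp Require Import boolp classical_sets functions cardinality.

Set Implicit Arguments.
Unset Strict Implicit.
Unset Printing Implicit Defensive.

Import Order.TTheory GRing.Theory Num.Theory.

Local Open Scope ring_scope.
Local Open Scope classical_set_scope.

Definition col_span (n : nat) (A : 'M[int]_n) : set 'cV[int]_n :=
  [set v | exists c : 'cV[int]_n, v = A *m c].

Definition mul_closed (n : nat) (S : set 'cV[int]_n) : Prop :=
  forall u v, S u -> S v -> S (map2_mx *%R u v).

(* The diagonal beta has n - 1 entries; [emb] identifies the index set
   {1, ..., n-1} with the first n - 1 indices of an n x n matrix. *)
Definition emb (n : nat) (i : 'I_n.-1) : 'I_n := widen_ord (leq_pred n) i.

Record irreducible_subring_matrix (p n : nat) (beta : 'I_n.-1 -> nat)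
    (A : 'M[int]_n) : Prop := IrreducibleSubringMatrix {
  ism_upper : forall i j : 'I_n, (j < i)%N -> A i j = 0 ;
  ism_diag : forall i : 'I_n.-1, A (emb i) (emb i) = (p ^ beta i)%N%:Z ;
  (* j.+1 = n says that j is the last index; i = j gives A_nn = 1. *)
  ism_last : forall i j : 'I_n, j.+1 = n -> A i j = 1 ;
  ism_above : forall i j : 'I_n.-1, (i < j)%N ->
    exists a : int, 0 <= a <= (p ^ (beta i).-1)%N%:Z - 1
                    /\ A (emb i) (emb j) = p%:Z * a ;
  ism_closed : mul_closed (col_span A)
}.

Definition irreducible_subring_matrices (p n : nat) (beta : 'I_n.-1 -> nat) :
  set 'M[int]_n := [set A | irreducible_subring_matrix p beta A].

(* [fset_set] is the empty set on infinite sets, so the cardinal below is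
   meaningful thanks to this lemma. *)
Lemma finite_irreducible_subring_matrices (p n : nat) (beta : 'I_n.-1 -> nat) :
  finite_set (irreducible_subring_matrices p beta).
Proof.
pose B := (\sum_(i < n.-1) (p ^ beta i + p * p ^ (beta i).-1)).+1%N.
have leB (i : 'I_n.-1) : (p ^ beta i + p * p ^ (beta i).-1 < B)%N.
  by rewrite ltnS (bigD1 i) //= leq_addr.
have bnd (A : 'M[int]_n) : irreducible_subring_matrix p beta A ->
    forall i j, exists m : 'I_B.+1, A i j = (m : nat)%:Z.
  move=> [up dg la ab _] i j.
  suff [m mB ->] : exists2 m : nat, (m < B.+1)%N & A i j = m%:Z.
    by exists (Ordinal mB).
  have [jl|jl] := eqVneq j.+1 n; first by exists 1%N => //; exact: la.
  have [ji|ij] := ltnP j i; first by exists 0%N => //; exact: up.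
  have hj : (j < n.-1)%N.
    by rewrite -ltnS (ltn_predK (ltn_ord j)) ltn_neqAle jl ltn_ord.
  have hi : (i < n.-1)%N := leq_ltn_trans ij hj.
  have ei : i = emb (Ordinal hi) by apply: val_inj.
  have ej : j = emb (Ordinal hj) by apply: val_inj.
  have hB := leB (Ordinal hi).
  move: ij; rewrite leq_eqVlt => /orP[/eqP /val_inj ij|ij].
    exists (p ^ beta (Ordinal hi))%N; last by rewrite -ij -dg -ei.
    by rewrite ltnS ltnW // (leq_ltn_trans _ hB) // leq_addr.
  have [a [/andP[a0 aU] Aij]] := ab (Ordinal hi) (Ordinal hj) ij.
  move: a0 aU Aij; case: a => // a _ aU Aij.
  exists (p * a)%N; last by rewrite PoszM -Aij -ei -ej.
  rewrite ltnS ltnW // (leq_ltn_trans _ hB) // (leq_trans _ (leq_addl _ _)) //.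
  by rewrite leq_mul2l -lez_nat (le_trans aU) ?orbT // lerBlDr lerDl.
apply: (@sub_finite_set _ _ (range (fun M : 'M['I_B.+1]_n =>
    map_mx (fun m : 'I_B.+1 => (m : nat)%:Z) M))); last first.
  exact/finite_image/finite_finset.
move=> A /bnd hA.
pose m i j := projT1 (cid (hA i j)).
exists (\matrix_(i, j) m i j) => //; apply/matrixP => i j.
by rewrite !mxE /m; case: cid => /= x ->.
Qed.

Definition g_diag (p n : nat) (beta : 'I_n.-1 -> nat) : nat :=
  #|` fset_set (irreducible_subring_matrices p beta)|%fset.

Definition scale_at (m : nat) (alpha : 'I_m -> nat) (k : nat) (t : 'I_m) :
  'I_m -> nat := fun i => if i == t then (k * alpha t)%N else alpha i.

(* Main.v *)
(** Allowing p^(beta i) values for each off-diagonal entry of row i gives the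
    exponent (n - 2) k alpha_t plus a constant independent of k. To absorb that
    constant for large k (when n > 2) it is enough to save a positive proportion
    of N = k alpha_t in a single entry of row t. If t is not the first row, the entry in the first column is
    zero. If it is, the entry x next to the diagonal satisfies
    p^N | x (x - p^(alpha_2)), so p^(N/2) divides x or x - p^(alpha_2). The
    implied constant is then 1. *)
Require Import Defs.
From mathcomp Require Import all_boot.
From mathcomp Require Import all_algebra finmap zify.
From mathcomp Require Import classical_sets cardinality.

Set Implicit Arguments.
Unset Strict Implicit.
Unset Printing Implicit Defensive.

Import GRing.Theory Num.Theory.

Local Open Scope nat_scope.

(** The [p]-adic valuations of [a] and [b] add up to at least [2h], so one of them is at least [h];
    a zero factor is divisible by everything. *)
Lemma dvdn_pfactor_mul (p h a b : nat) : prime p ->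
  p ^ (h + h) %| a * b -> (p ^ h %| a) || (p ^ h %| b).
Proof.
move=> pp; case: (posnP a) => [->|a0]; first by rewrite dvdn0.
case: (posnP b) => [->|b0]; first by rewrite dvdn0 orbT.
rewrite !pfactor_dvdn ?muln_gt0 ?a0 // lognM //; lia.
Qed.

Lemma card_seq_preim (B : nat) (s : seq nat) :
  #|[pred x : 'I_B | val x \in s]| <= size s.
Proof.
rewrite cardE -(size_map val); apply: uniq_leq_size.
  by rewrite (map_inj_uniq val_inj) enum_uniq.
by move=> y /mapP[x]; rewrite mem_enum inE => xs ->.
Qed.

Lemma card_fset_set_leq (T : choiceType) (U : finType) (S : set T) (f : T -> U)
    (D : {pred U}) : finite_set S -> (forall x, S x -> f x \in D) ->
  (forall x y, S x -> S y -> f x = f y -> x = y) -> #|` fset_set S|%fset <= #|D|.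
Proof.
move=> Sfin fD finj.
have inS x : (x \in fset_set S) -> S x by rewrite in_fset_set // => /set_mem.
rewrite cardE -(size_map f) uniq_leq_size //.
  by rewrite map_inj_in_uniq ?fset_uniq // => x y /inS xS /inS yS; exact: finj.
by move=> y /mapP[x /inS xS ->]; rewrite mem_enum fD.
Qed.

Lemma ord_last_or_emb (n : nat) (i : 'I_n) :
  i.+1 = n \/ exists i' : 'I_n.-1, i = emb i'.
Proof.
have [->|il] := eqVneq i.+1 n; first by left.
have hi : i < n.-1 by have := ltn_ord i; lia.
by right; exists (Ordinal hi); apply: val_inj.
Qed.

(** The last column is all ones and the last row is zero before it, so a matrix is determined by its
    leading block of size [n.-1]; candidates for the entries of that block are then counted
    independently. *)
Lemma g_diag_leq (p n : nat) (beta : 'I_n.-1 -> nat)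
    (s : 'I_n.-1 -> 'I_n.-1 -> seq nat) :
  (forall A, irreducible_subring_matrix p beta A -> forall i j,
     exists2 x : nat, x \in s i j & A (emb i) (emb j) = Posz x) ->
  g_diag p beta <= \prod_i \prod_j size (s i j).
Proof.
move=> sP; rewrite pair_big /=.
(* A crude bound on all candidates, so that the blocks become functions into the finite type
   ['I_B.+1]. *)
pose B := \sum_i \sum_j \sum_(x <- s i j) x.
have ltB i j x : x \in s i j -> x < B.+1.
  move=> xs; rewrite ltnS /B (bigD1 i) //= (bigD1 j) //= (big_rem x) //=.
  by rewrite -!addnA leq_addr.
pose f (A : 'M[int]_n) : {ffun 'I_n.-1 * 'I_n.-1 -> 'I_B.+1} :=
  [ffun ij => inord `|A (emb ij.1) (emb ij.2)|%N].
pose F (ij : 'I_n.-1 * 'I_n.-1) := [pred x : 'I_B.+1 | val x \in s ij.1 ij.2].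
apply: (@leq_trans #|family F|).
  apply: (card_fset_set_leq (f := f)).
  - exact: finite_irreducible_subring_matrices.
  - move=> A Aism; apply/familyP => -[i j]; rewrite ffunE /F inE /=.
    by have [x xs ->] := sP A Aism i j; rewrite inordK ?(ltB i j).
  move=> A A' Aism A'ism /ffunP ff; apply/matrixP => i j.
  have [jl|[j' jE]] := ord_last_or_emb j.
    by rewrite (ism_last Aism) // (ism_last A'ism).
  have [il|[i' iE]] := ord_last_or_emb i.
    have ji : (j < i)%N by rewrite jE /=; have := ltn_ord j'; lia.
    by rewrite (ism_upper Aism) // (ism_upper A'ism).
  have := ff (i', j'); rewrite !ffunE /= iE jE.
  have [x xs ->] := sP A Aism i' j'; have [y ys ->] := sP A' A'ism i' j'.
  by move=> /(congr1 val) /=; rewrite !inordK ?(ltB i' j') //= => ->.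
rewrite card_family foldrE big_map big_enum /=.
by apply: leq_prod => ij _; exact: card_seq_preim.
Qed.

Section Entries.
Local Open Scope ring_scope.

(** Back substitution from the last row upwards, by induction on [n - i]. *)
Lemma upper_triangular_solution0 (R : idomainType) (n : nat) (A : 'M[R]_n)
    (c : 'cV[R]_n) (r : nat) :
  (forall i j : 'I_n, (j < i)%N -> A i j = 0) -> (forall i, A i i != 0) ->
  (forall i : 'I_n, (r < i)%N -> (A *m c) i 0 = 0) ->
  forall i : 'I_n, (r < i)%N -> c i 0 = 0.
Proof.
move=> up dg Ac i; have [m] := ubnP (n - i); elim: m i => // m IH i im ri.
have := Ac i ri; rewrite mxE (bigD1 i) //= big1 ?addr0; last first.
  move=> j ji; have [lt_ji|le_ij] := ltnP j i; first by rewrite up ?mul0r.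
  have lt_ij : (i < j)%N by rewrite ltn_neqAle eq_sym ji.
  rewrite IH ?mulr0 //; last exact: ltn_trans lt_ij.
  by have := ltn_ord j; lia.
by move/eqP; rewrite mulf_eq0 (negPf (dg i)) => /eqP.
Qed.

Variables (p n : nat) (beta : 'I_n.-1 -> nat) (A : 'M[int]_n).
Hypotheses (p_gt0 : (0 < p)%N) (Aism : irreducible_subring_matrix p beta A).

Lemma ism_diag_neq0 (i : 'I_n) : A i i != 0.
Proof.
have [il|[i' ->]] := ord_last_or_emb i; first by rewrite (ism_last Aism).
by rewrite (ism_diag Aism) eqz_nat -lt0n expn_gt0 p_gt0.
Qed.

Lemma ism_offdiag (i j : 'I_n.-1) : i != j -> (0 < beta i)%N ->
  exists2 x : nat, (x < p ^ beta i)%N & A (emb i) (emb j) = x%:Z.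
Proof.
move=> ij b0; have [ji|le_ij] := ltnP j i.
  by exists 0%N; rewrite ?expn_gt0 ?p_gt0 // (ism_upper Aism).
have lt_ij : (i < j)%N by rewrite ltn_neqAle ij.
have [a [aB ->]] := ism_above Aism lt_ij.
case: a aB => // a aB; exists (p * a)%N => //.
rewrite -(prednK b0) expnS ltn_pmul2l //; lia.
Qed.

(** By back substitution, a vector of the span supported on the first coordinate involves the first
    column only. *)
Lemma ism_span_first (c : 'cV[int]_n) (i0 : 'I_n.-1) : i0 = 0%N :> nat ->
  (forall i : 'I_n, (0 < i)%N -> (A *m c) i 0 = 0) ->
  exists y, (A *m c) (emb i0) 0 = (p ^ beta i0)%N%:Z * y.
Proof.
move=> i00 Ac; exists (c (emb i0) 0).
have c0 := upper_triangular_solution0 (ism_upper Aism) ism_diag_neq0 Ac.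
rewrite mxE (bigD1 (emb i0)) //= big1 ?addr0 ?(ism_diag Aism) //.
move=> j jn; rewrite c0 ?mulr0 // lt0n; apply: contra jn => /eqP j0.
by apply/eqP/val_inj; rewrite /= i00.
Qed.

(* The second column v = (x, p^b, 0, ..., 0) gives v * v - p^b v =
   (x (x - p^b), 0, ..., 0), which must be a multiple of the first column. *)
Lemma ism_second_column (i0 i1 : 'I_n.-1) : i0 = 0%N :> nat -> i1 = 1%N :> nat ->
  let x := A (emb i0) (emb i1) in
  exists y, x * (x - (p ^ beta i1)%N%:Z) = (p ^ beta i0)%N%:Z * y.
Proof.
move=> i00 i11 x.
pose v := A *m delta_mx (emb i1) (0 : 'I_1).
have vE i : v i 0 = A i (emb i1) by rewrite /v -colE mxE.
have [c cE] : col_span A (map2_mx *%R v v).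
  by apply: (ism_closed Aism); exists (delta_mx (emb i1) 0).
pose c' := c - (p ^ beta i1)%N%:Z *: delta_mx (emb i1) (0 : 'I_1).
have c'E i : (A *m c') i 0 = A i (emb i1) * (A i (emb i1) - (p ^ beta i1)%N%:Z).
  have -> : A *m c' = map2_mx *%R v v - (p ^ beta i1)%N%:Z *: v.
    by rewrite /c' mulmxBr -cE -scalemxAr.
  by rewrite -vE; move: v {vE cE} => v; rewrite !mxE mulrBr [v i 0 * _%:Z]mulrC.
have [|y yE] := @ism_span_first c' i0 i00; last by exists y; rewrite -yE c'E.
move=> i i_gt0; rewrite c'E.
have [->|ne] := eqVneq i (emb i1); first by rewrite (ism_diag Aism) subrr mulr0.
rewrite (ism_upper Aism) ?mul0r //= i11.
have : (i : nat) != 1%N.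
  by apply: contra ne => /eqP i1E; apply/eqP/val_inj; rewrite /= i11.
by lia.
Qed.

End Entries.

(** The candidates congruent to 0 or [p ^ b] modulo [p ^ h]. Taking [q = p ^ (N - h)] covers the
    range below [p ^ N] when [b <= h]. *)
Definition two_progressions (p b h q : nat) : seq nat :=
  [seq e + p ^ h * r | e <- [:: 0; p ^ b], r <- iota 0 q].

Lemma mem_two_progressions (p b h N x : nat) : prime p -> b <= h -> h + h <= N ->
  x < p ^ N -> (p ^ h %| `|(x%:Z - (p ^ b)%:Z)%R| ) || (p ^ h %| x) ->
  x \in two_progressions p b h (p ^ (N - h)).
Proof.
move=> pp bh hN xN.
have ph0 : 0 < p ^ h by rewrite expn_gt0 prime_gt0.
have NE : p ^ N = p ^ (N - h) * p ^ h by rewrite -expnD subnK //; lia.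
have mem e r : e \in [:: 0; p ^ b] -> x = e + p ^ h * r ->
    x \in two_progressions p b h (p ^ (N - h)).
  move=> eS xE; apply/allpairsP; exists (e, r); split=> //=.
  rewrite mem_iota /= add0n -(ltn_pmul2r ph0) -NE mulnC.
  by apply: leq_ltn_trans xN; rewrite xE leq_addl.
have mem0 : p ^ h %| x -> x \in two_progressions p b h (p ^ (N - h)).
  by case/dvdnP => r xE; apply: (mem 0 r); rewrite ?inE // add0n mulnC.
case/orP => // hd; have [le|lt] := leqP (p ^ b) x.
  have {}hd : p ^ h %| x - p ^ b by rewrite -(distnEl le).
  by case/dvdnP: hd => r rE; apply: (mem (p ^ b) r); rewrite ?inE ?eqxx ?orbT //; lia.
(* Here [p ^ b - x] is a positive multiple of [p ^ h] and at most [p ^ b <= p ^ h], which forces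
   [x = 0]. *)
have {}hd : p ^ h %| p ^ b - x by rewrite -(distnEr (ltnW lt)).
apply: mem0; have := dvdn_leq _ hd; rewrite subn_gt0 => /(_ lt).
have : p ^ b <= p ^ h by rewrite leq_pexp2l ?prime_gt0.
by move=> ? ?; have -> : x = 0 by lia.
Qed.

Theorem theorem1p5 (p n : nat) (p_prime : prime p) (n_gt1 : 1 < n) :
  exists C : nat,
    forall (alpha : 'I_n.-1 -> nat) (t : 'I_n.-1),
      (forall i : 'I_n.-1, 1 < alpha i) ->
      exists K : nat, forall k : nat, 1 <= k -> K <= k ->
        g_diag p (scale_at alpha k t)
          <= C * p ^ ((\max_(i < n.-1 | i <= t) alpha i) * k * (n - 2)).
Proof.
exists 1 => alpha t alpha_gt1.
(* [M] bounds both each single [alpha i] and the total exponent contributed by the rows other than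
   [t]. *)
pose M := \sum_i \sum_(j < n.-1) alpha i.
exists M.+2 => k k_gt0 kM; rewrite mul1n.
have p_gt0 := prime_gt0 p_prime.
set beta := scale_at alpha k t.
have beta_gt0 i : 0 < beta i.
  by rewrite /beta /scale_at; case: ifP => _; have := alpha_gt1 i;
     have := alpha_gt1 t; nia.
have beta_t : beta t = k * alpha t by rewrite /beta /scale_at eqxx.
have beta_nt i : i != t -> beta i = alpha i.
  by rewrite /beta /scale_at => /negPf ->.
have alphaM i : alpha i <= M.
  by rewrite /M (bigD1 i) //= (bigD1 i) //= -addnA leq_addr.
(* For [n = 2] the block is one prescribed diagonal entry and the target exponent is 0. *)
have [n_le2|n_gt2] := leqP n 2.
  have one (i j : 'I_n.-1) : i = j.
    by apply: val_inj; have := ltn_ord i; have := ltn_ord j; rewrite /=; lia.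
  apply: leq_trans (_ : 1 <= _); last by rewrite expn_gt0 p_gt0.
  apply: leq_trans (g_diag_leq (s := fun i _ => [:: p ^ beta i]) _) _.
    move=> A Aism i j; rewrite (one j i) (ism_diag Aism).
    by exists (p ^ beta i); rewrite ?inE.
  by rewrite big1 // => i _; rewrite big1.
have m0 : 0 < n.-1 by lia.
have m1 : 1 < n.-1 by lia.
pose i0 := Ordinal m0; pose i1 := Ordinal m1.
(* Column of the entry of row [t] on which the saving is made. *)
pose j1 := if t == i0 then i1 else i0.
have j1t : j1 != t by rewrite /j1; have [->|] := eqVneq t i0; rewrite // eq_sym.
pose N := k * alpha t; pose h := N./2.
have hN : h + h <= N by rewrite addnn /h; lia.
(* Since [alpha t >= 2], the saving [h] grows at least as fast as [k]. *)
have kh : k <= h by rewrite /h; have := alpha_gt1 t; rewrite /N; nia.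
pose L := two_progressions p (alpha i1) h (p ^ (N - h)).
pose s i j := if i == j then [:: p ^ beta i]
  else if (i == t) && (j == j1) then L else iota 0 (p ^ beta i).
(* Exponents bounding the number of candidates. The successor in [(N - h).+1] absorbs the factor
   [2 <= p] coming from the two progressions. *)
pose e i j := if i != t then alpha i else
  if j == t then 0 else if j == j1 then (N - h).+1 else N.
have sizeL : size L <= p ^ (N - h).+1.
  rewrite /L size_allpairs size_iota expnS leq_mul2r.
  by rewrite (prime_gt1 p_prime) orbT.
have size_s i j : size (s i j) <= p ^ e i j.
  rewrite /s /e; case: eqVneq => [->|ij].
    by rewrite /= expn_gt0 p_gt0.
  case: (eqVneq i t) => [it|it] /=; last by rewrite size_iota beta_nt.
  rewrite -it [j == i]eq_sym (negPf ij); case: ifP => // _.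
  by rewrite size_iota it beta_t.
have s_cover A : irreducible_subring_matrix p beta A -> forall i j,
    exists2 x : nat, x \in s i j & A (emb i) (emb j) = Posz x.
  move=> Aism i j; rewrite /s; case: eqVneq => [->|ij].
    by exists (p ^ beta j); rewrite ?inE ?(ism_diag Aism).
  have [x xlt xE] := ism_offdiag p_gt0 Aism ij (beta_gt0 i).
  case: ifP => [/andP[/eqP it /eqP jj]|_]; last first.
    by exists x; rewrite // mem_iota add0n.
  exists x => //; apply: mem_two_progressions => //.
  - by apply: leq_trans kh; have := alphaM i1; lia.
  - by rewrite /N -beta_t -it.
  (* When [t] is not the first row, the chosen entry lies below the diagonal, so it is 0 and belongs
     to the progression through 0. *)
  have [t0|t0] := eqVneq t i0; last first.
    suff -> : x = 0 by rewrite dvdn0 orbT.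
    have ji : emb j < emb i.
      rewrite jj it /j1 (negPf t0) /= lt0n; apply: contra t0 => /eqP t0.
      exact/eqP/val_inj.
    by move: xE; rewrite (ism_upper Aism ji) => -[].
  have j1E : j = i1 by rewrite jj /j1 t0 eqxx.
  have [y] := ism_second_column p_gt0 Aism (erefl : i0 = 0 :> nat)
    (erefl : i1 = 1 :> nat).
  rewrite -j1E -t0 -it xE it beta_t beta_nt ?jj // -jj j1E => yE.
  rewrite orbC; apply: dvdn_pfactor_mul => //.
  apply: dvdn_trans (dvdn_exp2l p hN) _.
  by apply/dvdnP; exists `|y|%N; rewrite -[x in LHS]/(absz (Posz x)) -abszM yE abszM mulnC.
apply: leq_trans (g_diag_leq s_cover) _.
apply: (@leq_trans (\prod_i \prod_j p ^ e i j)).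
  by apply: leq_prod => i _; apply: leq_prod => j _.
under eq_bigr => i _ do rewrite -expn_sum.
rewrite -expn_sum leq_pexp2l //.
(* The diagonal counts 0, column [j1] counts [(N - h).+1], and [n - 3] columns remain. *)
have row_t : \sum_j e t j <= (N - h).+1 + (n - 3) * N.
  rewrite (bigD1 t) //= (bigD1 j1) //= /e !eqxx /= (negPf j1t) add0n leq_add2l.
  apply: leq_trans (_ : \sum_(j < n.-1 | (j != t) && (j != j1)) N <= _).
    by apply: leq_sum => j /andP[/negPf-> /negPf->].
  rewrite sum_nat_const leq_mul2r; apply/orP; right.
  have : #|[set~ t] :\ j1| = n - 3.
    have := cardsD1 j1 [set~ t]; rewrite !inE j1t cardsC1 card_ord; lia.
  move=> <-; apply: eq_leq; apply: eq_card => j.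
  by rewrite !inE andbC.
have rows : \sum_(i | i != t) \sum_j e i j <= M.
  rewrite /M [leqRHS](bigD1 t) //=; apply: leq_trans (leq_addl _ _).
  by apply: leq_sum => i it; apply: leq_sum => j _; rewrite /e it.
have gammaN : N * (n - 2) <= (\max_(i < n.-1 | i <= t) alpha i) * k * (n - 2).
  rewrite leq_mul2r /N mulnC leq_mul2r; apply/orP; right; apply/orP; right.
  exact: (leq_bigmax_cond (P := fun i : 'I_n.-1 => i <= t)).
apply: leq_trans gammaN; rewrite (bigD1 t) //=.
(* One copy of [N] is split off to pay for [(N - h).+1 + M]. This needs [M < h], which follows from
   [M.+2 <= k <= h]. *)
have -> : n - 2 = (n - 3).+1 by lia.
rewrite mulnS [N * _]mulnC; apply: leq_trans (leq_add row_t rows) _.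
rewrite addnAC leq_add2r; move: kM kh hN; clear; clearbody N h M; lia.
Qed.
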